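(* Let $A\subseteq\Gamma$ be a finite set, $D=A-A$, $S=A+A$. Then $$\mathsf{E}_3^2(D,A,A),\ \mathsf{E}_3^2(S,A,A)\ \ge\ \frac{|A|^{13}}{|A-A|^2\,\mathsf{E}(A)},$$ and $$(\mathsf{E}^D_3(D))^4\ge\max\Big\{|D|^{12},\frac{|A|^{45}}{\mathsf{E}^9(A)|D|^2}\Big\},\qquad (\mathsf{E}^D_3(S))^4\ge\max\Big\{|S|^{12},\frac{|A|^{45}}{\mathsf{E}^9(A)|D|^2}\Big\}.$$ Further, let $\beta,\gamma\in[0,1]$ with $\beta\le1/2$. If $A$ is $(2,\beta,\gamma)$-connected then $\mathsf{E}_3^2(D,A,A),\ \mathsf{E}_3^2(S,A,A)\gg\gamma|A|^5\mathsf{E}(A)$. If $A$ is $(3/2,\beta,\gamma)$-connected then $$\mathsf{E}^D_3(D),\ \mathsf{E}^D_3(S)\gg\gamma\frac{|A|^{33/4}\mathsf{E}_{3/2}(A)}{\mathsf{E}^{9/4}(A)\log|A|},$$ and if $A$ is $(2,\beta,\gamma)$-connected then $$\mathsf{E}^D_3(D),\ \mathsf{E}^D_3(S)\gg\gamma\frac{|A|^{17/2}}{\mathsf{E}^{3/2}(A)\log|A|}.$$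
   Context: $\Gamma$ is an abelian group, all sets finite and identified with indicator functions. $(f\circ g)(x)=\sum_y f(y)g(y+x)$. For $X\subseteq\Gamma$, $X_s=X\cap(X-s)$, so $|X_s|=(X\circ X)(s)$. $\mathsf{E}(A)=\sum_x(A\circ A)(x)^2$, $\mathsf{E}_k(A)=\sum_x(A\circ A)(x)^k$ for real $k\ge1$. $\mathsf{E}_3(X,A,A)=\sum_x(X\circ X)(x)(A\circ A)(x)^2$. For $P\subseteq\Gamma$, $\mathsf{E}^P_k(X)=\sum_{s\in P}|X_s|^k$. For real $\alpha>1$, $A$ is $(\alpha,\beta,\gamma)$-connected if every $B\subseteq A$ with $|B|\ge\beta|A|$ satisfies $\mathsf{E}_\alpha(B)\ge\gamma(|B|/|A|)^{2\alpha}\mathsf{E}_\alpha(A)$. $\ll,\gg$ hide absolute constants; logarithms base 2. *)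

(* Defs.v *)
From HB Require Import structures.
From mathcomp Require Import all_boot all_order all_algebra.
From mathcomp Require Import finmap.
From mathcomp Require Import reals exp.
Set Implicit Arguments. Unset Strict Implicit. Unset Printing Implicit Defensive.
Import Order.TTheory GRing.Theory Num.Theory.
Local Open Scope ring_scope.
Local Open Scope fset_scope.

Section Defs.
Variable T : zmodType.

Definition sumset (A B : {fset T}) : {fset T} := [fset (a + b)%R | a : T in A, b : T in B].
Definition diffset (A B : {fset T}) : {fset T} := [fset (a - b)%R | a : T in A, b : T in B].

(* (X o X)(x) = |X_x| = |X cap (X - x)| = #{y in X | y + x in X} *)
Definition rep (X : {fset T}) (x : T) : nat := #|` [fset y in X | (y + x)%R \in X] |.

(* E(A) = sum_x (A o A)(x)^2 ; (A o A) is supported on A - A *)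
Definition energy (A : {fset T}) : nat := \sum_(x <- diffset A A) rep A x ^ 2.

(* E_3(X,A,A) = sum_x (X o X)(x) (A o A)(x)^2 ; supported on A - A *)
Definition energy3 (X A : {fset T}) : nat :=
  \sum_(x <- diffset A A) rep X x * rep A x ^ 2.

Definition energyP (k : nat) (P X : {fset T}) : nat := \sum_(s <- P) rep X s ^ k.

Variable R : realType.

Definition energyR (k : R) (A : {fset T}) : R :=
  \sum_(x <- diffset A A) (rep A x)%:R `^ k.

Definition connected (alpha beta gamma : R) (A : {fset T}) : Prop :=
  forall B : {fset T}, B `<=` A -> beta * (#|` A|)%:R <= (#|` B|)%:R ->
    gamma * (((#|` B|)%:R / (#|` A|)%:R) `^ (2 * alpha)) * energyR alpha A
      <= energyR alpha B.

End Defs.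

Definition log2 {R : realType} (x : R) : R := ln x / ln 2.

(* Main.v *)
Require Import Defs.
From HB Require Import structures.
From mathcomp Require Import all_boot all_order all_algebra.
From mathcomp Require Import finmap.
From mathcomp Require Import reals exp.
From mathcomp Require Import ring lra.
Import Order.TTheory GRing.Theory Num.Theory.
Local Open Scope ring_scope.

(** Write [n_s = |X_s|] with [X = D] or [X = S], and let [d p] be the sum of
    [|A_(q-p)|] over [q] in [A], so that the sum of [d] over [A] is [E(A)].
    The Katz-Koester inclusion [X_s >= A_s -/+ A] and Cauchy-Schwarz weighted by
    [1/d] give [n_s >= |A|^2 (f o f)(s)] with [f = d^(-1/2)].  On the other hand
    Cauchy-Schwarz over the pairs [(q - p, p -/+ c)] with [c, p, q] in [A] bounds
    [(sum h(c) k(p) l(q) v(q-p))^2] by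
    [(sum n_s v_s^2) (sum (h o h)(k o k)(l o l))].  Estimating the last factor by
    the pointwise bound on [f o f] gives [E_3(X,A,A) >= |A|^2 sum d^(1/2)] and
    [E_3^D(X)^4 |D|^2 >= |A|^18 (sum d^(-1/2))^18], from which the unconditional
    bounds follow by Hoelder.  In the connected case one restricts to the half
    of [A] on which [d], or its square root, is at most twice its mean. *)

(** * Cauchy-Schwarz and Hoelder inequalities for finite sums *)

Section SumInequalities.
Variable R : realFieldType.

Lemma cauchy_schwarz_wsum (I : Type) (r : seq I) (w x y : I -> R) :
  (forall i, 0 <= w i) ->
  (\sum_(i <- r) w i * x i * y i) ^+ 2
    <= (\sum_(i <- r) w i * x i ^+ 2) * (\sum_(i <- r) w i * y i ^+ 2).
Proof.
move=> w0; elim: r => [|i r IH]; first by rewrite !big_nil mul0r expr0n.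
have U0 : 0 <= \sum_(j <- r) w j * x j ^+ 2.
  by apply: sumr_ge0 => j _; rewrite mulr_ge0 ?sqr_ge0.
have V0 : 0 <= \sum_(j <- r) w j * y j ^+ 2.
  by apply: sumr_ge0 => j _; rewrite mulr_ge0 ?sqr_ge0.
rewrite !big_cons; move: IH U0 V0.
set U := \sum_(j <- r) w j * x j ^+ 2; set V := \sum_(j <- r) w j * y j ^+ 2.
move: (\sum_(j <- r) _) U V => u U V uUV U0 V0.
(* The cross term created by the new entry: from [u ^+ 2 <= U * V], its square is at most
   [4 * (U * y i ^+ 2) * (V * x i ^+ 2)], and AM-GM finishes. *)
have key : 2 * u * x i * y i <= U * y i ^+ 2 + V * x i ^+ 2.
  have s0 : 0 <= U * y i ^+ 2 + V * x i ^+ 2.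
    by apply: addr_ge0; apply: mulr_ge0 => //; apply: sqr_ge0.
  apply: le_trans (ler_norm _) _.
  rewrite -ler_sqr ?nnegrE // real_normK ?num_real //.
  have := sqr_ge0 (U * y i ^+ 2 - V * x i ^+ 2).
  have : u ^+ 2 * (x i * y i) ^+ 2 <= U * V * (x i * y i) ^+ 2.
    by rewrite ler_wpM2r ?sqr_ge0.
  by move=> h1 h2; nra.
have := ler_wpM2l (w0 i) key.
by nra.
Qed.

(** Two uses of Cauchy-Schwarz. With [S], [M] the sums of [a * b ^+ 2] and [b * a ^+ 2], and [P],
    [Q] those of the cubes, S^2 <= M Q and M^2 <= P S. Hence S^4 <= P S Q^2, and one factor S
    cancels. *)
Lemma hoelder_cube_sum (I : Type) (r : seq I) (a b : I -> R) :
  (forall i, 0 <= a i) -> (forall i, 0 <= b i) ->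
  (\sum_(i <- r) a i * b i ^+ 2) ^+ 3
    <= (\sum_(i <- r) a i ^+ 3) * (\sum_(i <- r) b i ^+ 3) ^+ 2.
Proof.
move=> a0 b0.
have := cauchy_schwarz_wsum I r b a b b0.
have := cauchy_schwarz_wsum I r a a b a0.
have E1 : \sum_(i <- r) b i * a i * b i = \sum_(i <- r) a i * b i ^+ 2.
  by apply: eq_bigr => i _; ring.
have E2 : \sum_(i <- r) a i * a i * b i = \sum_(i <- r) b i * a i ^+ 2.
  by apply: eq_bigr => i _; ring.
have E3 (c : I -> R) : \sum_(i <- r) c i * c i ^+ 2 = \sum_(i <- r) c i ^+ 3.
  by apply: eq_bigr => i _; ring.
rewrite E1 E2 !E3.
have S0 : 0 <= \sum_(i <- r) a i * b i ^+ 2.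
  by apply: sumr_ge0 => i _; rewrite mulr_ge0 ?sqr_ge0.
have M0 : 0 <= \sum_(i <- r) b i * a i ^+ 2.
  by apply: sumr_ge0 => i _; rewrite mulr_ge0 ?sqr_ge0.
have P0 : 0 <= \sum_(i <- r) a i ^+ 3.
  by apply: sumr_ge0 => i _; rewrite exprn_ge0.
have Q0 : 0 <= \sum_(i <- r) b i ^+ 3.
  by apply: sumr_ge0 => i _; rewrite exprn_ge0.
move: S0 M0 P0 Q0.
set S := \sum_(i <- r) a i * b i ^+ 2; set M := \sum_(i <- r) b i * a i ^+ 2.
set P := \sum_(i <- r) a i ^+ 3; set Q := \sum_(i <- r) b i ^+ 3.
move=> S0 M0 P0 Q0 h1 h2.
have [S00|Sn0] := eqVneq S 0; first by rewrite S00 expr0n mulr_ge0 ?sqr_ge0.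
have Sp : 0 < S by rewrite lt_neqAle eq_sym Sn0.
rewrite -(ler_pM2l Sp) -exprS.
have : (S ^+ 2) ^+ 2 <= (M * Q) ^+ 2 by rewrite ler_sqr ?nnegrE ?sqr_ge0 ?mulr_ge0.
have := ler_wpM2r (sqr_ge0 Q) h1.
rewrite (_ : S ^+ 4 = (S ^+ 2) ^+ 2); last by rewrite -exprM.
move=> h3 h4; apply: le_trans h4 _; rewrite exprMn; apply: le_trans h3 _.
by rewrite [S * _]mulrA (mulrC S).
Qed.

(* The fibres of [m] over [t] partition the index set, so the second factor
   is the sum over [t] of the squared fibre weights. *)
Lemma cauchy_schwarz_fibre (I J : eqType) (r : seq I) (t : seq J) (m : I -> J)
    (w : I -> R) (v : J -> R) :
  uniq t -> (forall i, i \in r -> m i \in t) ->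
  (\sum_(i <- r) w i * v (m i)) ^+ 2
    <= (\sum_(j <- t) v j ^+ 2)
       * (\sum_(i <- r) \sum_(i' <- r) (m i == m i')%:R * (w i * w i')).
Proof.
move=> ut mt.
have pick1 i (F : J -> R) : i \in r ->
    \sum_(j <- t) (m i == j)%:R * F j = F (m i).
  move=> /mt mi; rewrite (bigD1_seq (m i)) //= eqxx mul1r big1 ?addr0 // => j.
  by rewrite eq_sym => /negbTE ->; rewrite mul0r.
have -> : \sum_(i <- r) w i * v (m i)
    = \sum_(j <- t) 1 * v j * \sum_(i <- r) (m i == j)%:R * w i.
  under [RHS]eq_bigr do rewrite mul1r mulr_sumr.
  rewrite exchange_big /= big_seq [RHS]big_seq; apply: eq_bigr => i ir.
  rewrite -[LHS](pick1 i (fun j => w i * v j) ir).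
  by apply: eq_bigr => j _; ring.
have -> : \sum_(i <- r) \sum_(i' <- r) (m i == m i')%:R * (w i * w i')
    = \sum_(j <- t) 1 * (\sum_(i <- r) (m i == j)%:R * w i) ^+ 2.
  under [RHS]eq_bigr do rewrite mul1r expr2 big_distrlr /=.
  rewrite [RHS]exchange_big /= big_seq [RHS]big_seq; apply: eq_bigr => i ir.
  rewrite [RHS]exchange_big /=; apply: eq_bigr => i' _.
  rewrite -[LHS](pick1 i (fun j => (j == m i')%:R * (w i * w i')) ir).
  by apply: eq_bigr => j _; rewrite [j == _]eq_sym; ring.
have := cauchy_schwarz_wsum J t (fun=> 1) v (fun j => \sum_(i <- r) (m i == j)%:R * w i) (fun=> ler01).
by under [X in _ <= X * _ -> _]eq_bigr do rewrite mul1r.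
Qed.

Lemma sum_le_sum_sqr (I : Type) (r : seq I) (x : I -> R) :
  (\sum_(i <- r) x i) ^+ 2 <= (\sum_(i <- r) 1) * \sum_(i <- r) x i ^+ 2.
Proof.
have := cauchy_schwarz_wsum I r (fun=> 1) (fun=> 1) x (fun=> ler01).
under eq_bigr do rewrite !mul1r.
under [in X in _ <= X * _ -> _]eq_bigr do rewrite mul1r expr1n.
by under [in X in _ <= _ * X -> _]eq_bigr do rewrite mul1r.
Qed.

Lemma sum_mul_sum_inv (I : eqType) (r : seq I) (x : I -> R) :
  (forall i, 0 <= x i) -> (forall i, i \in r -> 0 < x i) ->
  (\sum_(i <- r) 1) ^+ 2 <= (\sum_(i <- r) x i) * \sum_(i <- r) (x i)^-1.
Proof.
move=> x0 xp; have := cauchy_schwarz_wsum I r x (fun=> 1) (fun i => (x i)^-1) x0.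
have -> : \sum_(i <- r) x i * 1 * (x i)^-1 = \sum_(i <- r) 1.
  by apply: eq_big_seq => i /xp xi; rewrite mulr1 divff // gt_eqF.
have -> : \sum_(i <- r) x i * 1 ^+ 2 = \sum_(i <- r) x i.
  by apply: eq_bigr => i _; rewrite expr1n mulr1.
have -> // : \sum_(i <- r) x i * (x i)^-1 ^+ 2 = \sum_(i <- r) (x i)^-1.
by apply: eq_big_seq => i /xp xi; rewrite expr2 mulrA divff ?mul1r // gt_eqF.
Qed.

End SumInequalities.

(** * Correlations over [A], degrees, and the model common to [A - A] and [A + A] *)

Section Correlation.
Variables (R : realType) (T : zmodType) (A : {fset T}).
Local Notation D := (diffset A A).

(* [cor f] is the self-correlation [f o f] of the restriction of [f] to [A]. *)
Definition cor (f : T -> R) (x : T) : R :=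
  \sum_(p <- A) \sum_(q <- A) (q - p == x)%:R * (f p * f q).

(** Counts the triples of elements of [A] that complete [p] to an additive quadruple, whence its sum
    over [A] is the energy. *)
Definition deg (p : T) : R := \sum_(q <- A) (rep A (q - p))%:R.

Lemma mem_diffset (B : {fset T}) p q : p \in B -> q \in B -> q - p \in diffset B B.
Proof. by move=> pB qB; apply: (in_imfset2 _ (fun a b : T => a - b)). Qed.

Lemma corN f x : cor f (- x) = cor f x.
Proof.
rewrite /cor exchange_big; apply: eq_bigr => p _; apply: eq_bigr => q _.
by rewrite -(inj_eq oppr_inj) opprB opprK mulrC [f p * _]mulrC mulrC.
Qed.

Lemma cor_ge0 f x : (forall p, 0 <= f p) -> 0 <= cor f x.
Proof.
by move=> f0; do 2!apply: sumr_ge0 => ? _; rewrite !mulr_ge0.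
Qed.

Lemma sum_cor (f G : T -> R) :
  \sum_(x <- D) cor f x * G x
    = \sum_(p <- A) \sum_(q <- A) f p * f q * G (q - p).
Proof.
under eq_bigr do rewrite mulr_suml.
rewrite exchange_big; apply: eq_big_seq => p pA.
under eq_bigr do rewrite mulr_suml.
rewrite exchange_big; apply: eq_big_seq => q qA /=.
rewrite (bigD1_seq (q - p)) ?fset_uniq //=; last exact: mem_diffset.
rewrite eqxx mul1r big1 ?addr0 // => x.
by rewrite eq_sym => /negbTE ->; rewrite !mul0r.
Qed.

Lemma sum_eq_mem (B : {fset T}) (x : T) (F : T -> R) :
  \sum_(q <- B) (q == x)%:R * F q = (x \in B)%:R * F x.
Proof.
have [xB|xB] := boolP (x \in B).
  rewrite (bigD1_seq x) ?fset_uniq //= eqxx big1 ?addr0 // => q.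
  by move=> /negbTE ->; rewrite mul0r.
rewrite mul0r big_seq big1 // => q qB.
by case: eqP => [qx|_]; [rewrite -qx qB in xB | rewrite mul0r].
Qed.

Lemma rep_sum (B : {fset T}) x :
  (rep B x)%:R = \sum_(p <- B) \sum_(q <- B) (q - p == x)%:R :> R.
Proof.
transitivity (\sum_(p <- B) ((p + x \in B)%:R : R)); last first.
  apply: eq_bigr => p _; rewrite -[LHS]mulr1 -(sum_eq_mem B _ (fun=> 1)).
  by apply: eq_bigr => q _; rewrite mulr1 subr_eq addrC.
rewrite /rep card_fset_sum1 big_fset /= natr_sum big_mkcond /=.
by apply: eq_bigr => p _; case: ifP.
Qed.

Lemma sum_subset (B : {fset T}) (F : T -> R) :
  (B `<=` A)%fset -> \sum_(p <- B) F p = \sum_(p <- A) (p \in B)%:R * F p.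
Proof.
move=> sBA; transitivity (\sum_(p <- B) (p \in B)%:R * F p).
  by apply: eq_big_seq => p pB; rewrite pB mul1r.
by apply: big_fset_incl => // p _ /negbTE ->; rewrite mul0r.
Qed.

(** A subset enters through its indicator function, so that its correlations can be compared term by
    term with others over [A]. *)
Lemma rep_cor (B : {fset T}) x :
  (B `<=` A)%fset -> (rep B x)%:R = cor (fun p => (p \in B)%:R) x.
Proof.
move=> sBA; rewrite rep_sum.
rewrite sum_subset //; apply: eq_bigr => p _; rewrite sum_subset // mulr_sumr.
by apply: eq_bigr => q _; ring.
Qed.

Lemma rep_cor1 x : (rep A x)%:R = cor (fun=> 1) x.
Proof.
rewrite rep_sum; apply: eq_bigr => p _; apply: eq_bigr => q _.
by rewrite !mulr1.
Qed.

Lemma repN x : (rep A (- x))%:R = (rep A x)%:R :> R.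
Proof. by rewrite !rep_cor1 corN. Qed.

Lemma rep_eq0 (B : {fset T}) x : x \notin diffset B B -> rep B x = 0%N.
Proof.
move=> xD; apply/eqP; rewrite -(pnatr_eq0 R) rep_sum; apply/eqP.
rewrite big_seq big1 // => p pB; rewrite big_seq big1 // => q qB.
by case: eqP => // E; rewrite -E mem_diffset in xD.
Qed.

Lemma card_sum1 (B : {fset T}) : (#|` B|)%:R = \sum_(p <- B) 1 :> R.
Proof. by rewrite card_fset_sum1 natr_sum. Qed.

Lemma rep_sub (B C : {fset T}) x : (B `<=` C)%fset -> (rep B x <= rep C x)%N.
Proof.
move=> /fsubsetP sBC; apply: fsubset_leq_card; apply/fsubsetP => p.
by rewrite !inE /= => /andP[pB qB]; rewrite !sBC.
Qed.

Lemma rep0 (B : {fset T}) : rep B 0 = #|` B|.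
Proof. by congr #|` _|; apply/fsetP => p; rewrite !inE addr0 andbb. Qed.

Lemma deg_ge0 p : 0 <= deg p.
Proof. exact: sumr_ge0. Qed.

Lemma deg_gt0 p : p \in A -> 0 < deg p.
Proof.
move=> pA; apply: (@lt_le_trans _ _ (rep A (p - p))%:R).
  rewrite subrr rep0 ltr0n cardfs_gt0; apply/fset0Pn; by exists p.
rewrite /deg (bigD1_seq p) ?fset_uniq //= lerDl; exact: sumr_ge0.
Qed.

Lemma sum_deg : \sum_(p <- A) deg p = (energy A)%:R.
Proof.
rewrite /energy natr_sum.
transitivity (\sum_(x <- D) cor (fun=> 1) x * (rep A x)%:R).
  by rewrite sum_cor; apply: eq_bigr => p _; apply: eq_bigr => q _; rewrite !mul1r.
by apply: eq_bigr => x _; rewrite -rep_cor1 natrX expr2.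
Qed.

(** AM-GM on each product [w p * w q]; since the kernel is symmetric, both resulting sums collapse
    to the row sums [deg]. *)
Lemma rep_form_le_deg (w : T -> R) :
  \sum_(p <- A) \sum_(q <- A) (rep A (q - p))%:R * (w p * w q)
    <= \sum_(p <- A) w p ^+ 2 * deg p.
Proof.
set L := \sum_(p <- A) _.
have le2 : 2 * L <= \sum_(p <- A) \sum_(q <- A) (rep A (q - p))%:R * w p ^+ 2
          + \sum_(p <- A) \sum_(q <- A) (rep A (q - p))%:R * w q ^+ 2.
  rewrite mulr_sumr -big_split; apply: ler_sum => p _ /=.
  rewrite mulr_sumr -big_split; apply: ler_sum => q _ /=.
  rewrite -mulrDr mulrCA ler_wpM2l //.
  by have := sqr_ge0 (w p - w q); nra.
have E1 : \sum_(p <- A) \sum_(q <- A) (rep A (q - p))%:R * w p ^+ 2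
    = \sum_(p <- A) w p ^+ 2 * deg p.
  by apply: eq_bigr => p _; rewrite -mulr_suml mulrC.
have E2 : \sum_(p <- A) \sum_(q <- A) (rep A (q - p))%:R * w q ^+ 2
    = \sum_(p <- A) w p ^+ 2 * deg p.
  rewrite exchange_big -E1; apply: eq_bigr => p _; apply: eq_bigr => q _.
  by rewrite -repN opprB.
by rewrite E1 E2 in le2; lra.
Qed.

(* Covers [X = A - A] with [sg = -%R] and [X = A + A] with [sg = id]. *)
Definition sum_model (sg : T -> T) (X : {fset T}) : Prop :=
  (forall h x, \sum_(c <- A) \sum_(c' <- A) (sg c - sg c' == x)%:R * (h c * h c')
                 = cor h x)
  /\ (forall c p, c \in A -> p \in A -> sg c + p \in X).

Lemma sum_model_diffset : sum_model -%R D.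
Proof.
split=> [h x|c p cA pA]; last by rewrite addrC mem_diffset.
apply: eq_bigr => c _; apply: eq_bigr => c' _.
by rewrite opprK addrC.
Qed.

Lemma sum_model_sumset : sum_model id (sumset A A).
Proof.
split=> [h x|c p cA pA]; last by apply: (in_imfset2 _ (fun a b : T => a + b)).
rewrite exchange_big; apply: eq_bigr => c _; apply: eq_bigr => c' _.
by rewrite [h c' * _]mulrC.
Qed.

(** * Lower bounds for [rep X] and for the energies of [X] in terms of degrees *)

Section Model.
Variables (sg : T -> T) (X : {fset T}).
Hypothesis sgX : sum_model sg X.

(** The Katz-Koester points [sg c + p + tau] all lie in X_s. Cauchy-Schwarz over the pairs [(c, p)]
    with weight [1 / deg p] bounds the square of [n * ri] by |X_s| times the weighted number of
    coincidences, which is at most [ri]. *)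
Lemma rep_ge_sum_invdeg (s tau : T) (P : pred T) :
  (forall c p, c \in A -> p \in A -> P p ->
     (sg c + p + tau \in X) && (sg c + p + tau + s \in X)) ->
  (#|` A|)%:R ^+ 2 * \sum_(p <- A | P p) (deg p)^-1 <= (rep X s)%:R.
Proof.
move=> PX; have [hsg _] := sgX.
set ri := \sum_(p <- A | P p) _.
have ri0 : 0 <= ri by apply: sumr_ge0 => p _; rewrite invr_ge0 deg_ge0.
pose r := [seq (c, p) | c <- A, p <- [seq p <- A | P p]].
pose Xs := [fset y in X | (y + s)%R \in X]%fset.
have mr i : i \in r -> sg i.1 + i.2 + tau \in enum_fset Xs.
  move=> /allpairsP[[c p] /= [cA]]; rewrite mem_filter => /andP[Pp pA] -> /=.
  have /andP[h1 h2] := PX c p cA pA Pp.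
  by rewrite !inE /= h1.
have := cauchy_schwarz_fibre R _ _ r Xs (fun i => sg i.1 + i.2 + tau)
          (fun i => (deg i.2)^-1) (fun=> 1) (fset_uniq _) mr.
have -> : \sum_(i <- r) (deg i.2)^-1 * 1 = (#|` A|)%:R * ri.
  rewrite big_allpairs_dep /= card_sum1 mulr_suml; apply: eq_bigr => c _.
  by rewrite mul1r big_filter; apply: eq_bigr => p _; rewrite mulr1.
have -> : \sum_(j <- Xs) 1 ^+ 2 = (rep X s)%:R :> R.
  by rewrite [in RHS]/rep card_sum1; apply: eq_bigr => j _; rewrite expr1n.
set Q := (X in _ <= _ * X).
have Qle : Q <= ri.
  (* Two points coincide when [sg c - sg c' = q - p], so for fixed [p] and [q] there are
     [rep A (q - p)] coincidences. *)
  have -> : Q = \sum_(p <- A) \sum_(q <- A)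
      (rep A (q - p))%:R * (((P p)%:R / deg p) * ((P q)%:R / deg q)).
    rewrite /Q big_allpairs_dep /= exchange_big big_filter big_mkcond /=.
    apply: eq_bigr => p _; case: (P p); last first.
      by rewrite big1 // => q _; rewrite mul0r mul0r mulr0.
    under eq_bigr do rewrite big_allpairs_dep /= exchange_big big_filter.
    rewrite exchange_big big_mkcond /=; apply: eq_bigr => q _.
    case: (P q); last by rewrite mul0r !mulr0.
    rewrite rep_cor1 -hsg mulr_suml; apply: eq_bigr => c _.
    rewrite mulr_suml; apply: eq_bigr => c' _.
    rewrite (inj_eq (addIr _)) !mulr1 !mul1r; congr (_%:R * _).
    by rewrite -subr_eq0 -[in RHS]subr_eq0 opprD opprB addrACA.
  (* The weight [1 / deg] is chosen so that its square times [deg] is again [1 / deg]. *)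
  apply: le_trans (rep_form_le_deg _) _; rewrite /ri [leRHS]big_mkcond /=.
  rewrite big_seq [leRHS]big_seq; apply: ler_sum => p pA.
  case: (P p); last by rewrite mul0r expr0n mul0r.
  by rewrite mul1r expr2 -mulrA mulVf ?mulr1 // gt_eqF ?deg_gt0.
move=> h.
have [r0|rn0] := eqVneq ri 0; first by rewrite r0 mulr0.
have rp : 0 < ri by rewrite lt_neqAle eq_sym rn0.
rewrite -(ler_pM2r rp) -mulrA -expr2 -exprMn; apply: le_trans h _.
by rewrite ler_wpM2l.
Qed.

(* Uses the translates of both [A_s] and [A_s + s]; AM-GM turns the mean of
   the two bounds into a correlation. *)
Lemma rep_ge_cor_deg s :
  (#|` A|)%:R ^+ 2 * cor (fun p => (Num.sqrt (deg p))^-1) s <= (rep X s)%:R.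
Proof.
have [_ hX] := sgX.
have h1 : (#|` A|)%:R ^+ 2 * \sum_(p <- A | p + s \in A) (deg p)^-1 <= (rep X s)%:R.
  apply: (rep_ge_sum_invdeg s 0) => c p cA pA psA.
  by rewrite addr0 hX //= -addrA hX.
(* With [tau = - s] the points of X_s are indexed by the upper endpoint [q] of the pair
   [(q - s, q)], so the weight is the degree of that endpoint. *)
have h2 : (#|` A|)%:R ^+ 2 * \sum_(q <- A | q - s \in A) (deg q)^-1 <= (rep X s)%:R.
  apply: (rep_ge_sum_invdeg s (- s)) => c p cA pA psA.
  by rewrite subrK hX // -addrA hX.
have h3 : 2 * cor (fun p => (Num.sqrt (deg p))^-1) s
    <= \sum_(p <- A | p + s \in A) (deg p)^-1 + \sum_(q <- A | q - s \in A) (deg q)^-1.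
  have -> : \sum_(p <- A | p + s \in A) (deg p)^-1
      = \sum_(p <- A) \sum_(q <- A) (q - p == s)%:R * (deg p)^-1.
    rewrite big_mkcond; apply: eq_bigr => p _.
    under [RHS]eq_bigr do rewrite subr_eq [s + p]addrC.
    by rewrite (sum_eq_mem A _ (fun=> _)); case: ifP; rewrite ?mul1r ?mul0r.
  have -> : \sum_(q <- A | q - s \in A) (deg q)^-1
      = \sum_(p <- A) \sum_(q <- A) (q - p == s)%:R * (deg q)^-1.
    rewrite exchange_big big_mkcond; apply: eq_bigr => p _.
    under [RHS]eq_bigr do rewrite subr_eq addrC -subr_eq eq_sym.
    by rewrite (sum_eq_mem A _ (fun=> _)); case: ifP; rewrite ?mul1r ?mul0r.
  rewrite mulr_sumr -big_split; apply: ler_sum => p _ /=.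
  rewrite mulr_sumr -big_split; apply: ler_sum => q _ /=.
  rewrite -mulrDr mulrCA ler_wpM2l //.
  have sq x : (deg x)^-1 = (Num.sqrt (deg x))^-1 ^+ 2.
    by rewrite exprVn sqr_sqrtr ?deg_ge0.
  rewrite !sq.
  by have := sqr_ge0 ((Num.sqrt (deg p))^-1 - (Num.sqrt (deg q))^-1); nra.
have := ler_wpM2l (sqr_ge0 ((#|` A|)%:R : R)) h3.
by rewrite mulrDr mulrCA => h4; lra.
Qed.

(** A triple [(c, p, q)] is sent to [(q - p, sg c + p)]. The second entry lies in X_(q-p), because
    adding [q - p] gives [sg c + q]. Two triples have the same image exactly when [sg c - sg c'],
    [p' - p] and [q' - q] agree, which produces the three correlations at one point. *)
Lemma cauchy_schwarz_triple (h k l v : T -> R) :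
  (\sum_(c <- A) \sum_(p <- A) \sum_(q <- A) h c * k p * l q * v (q - p)) ^+ 2
    <= (\sum_(s <- D) (rep X s)%:R * v s ^+ 2)
       * (\sum_(x <- D) cor h x * cor k x * cor l x).
Proof.
have [hsg hX] := sgX.
pose r := [seq (c, i) | c <- A, i <- [seq (p, q) | p <- A, q <- A]].
pose t := [seq (s, e) | s <- D, e <- [fset y in X | (y + s)%R \in X]%fset].
pose m (i : T * (T * T)) := (i.2.2 - i.2.1, sg i.1 + i.2.1).
have ut : uniq t.
  apply: allpairs_uniq_dep => [|s _|]; rewrite ?fset_uniq //.
  by move=> [s e] [s' e'] _ _ /= [-> ->].
have mr i : i \in r -> m i \in t.
  move=> /allpairsP[[c j] /= [cA /allpairsP[[p q] /= [pA qA ->] ->]]].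
  apply/allpairsPdep; exists (q - p), (sg c + p); split=> //; first exact: mem_diffset.
  by rewrite !inE /= hX //= -addrA [p + _]addrC subrK hX.
have := cauchy_schwarz_fibre R _ _ r t m
  (fun i => h i.1 * k i.2.1 * l i.2.2) (fun j => v j.1) ut mr.
have -> : \sum_(i <- r) h i.1 * k i.2.1 * l i.2.2 * v (m i).1
   = \sum_(c <- A) \sum_(p <- A) \sum_(q <- A) h c * k p * l q * v (q - p).
  by rewrite big_allpairs_dep; apply: eq_bigr => c _; rewrite big_allpairs_dep.
have -> : \sum_(j <- t) v j.1 ^+ 2 = \sum_(s <- D) (rep X s)%:R * v s ^+ 2.
  rewrite big_allpairs_dep; apply: eq_bigr => s _ /=.
  rewrite /rep card_sum1 mulr_suml; apply: eq_bigr => e _.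
  by rewrite mul1r.
suff -> : \sum_(x <- D) cor h x * cor k x * cor l x
  = \sum_(i <- r) \sum_(i' <- r) (m i == m i')%:R
     * (h i.1 * k i.2.1 * l i.2.2 * (h i'.1 * k i'.2.1 * l i'.2.2)) by [].
(* The correlation of [k] is expanded first: the pair [(p, p')] fixes the common difference at which
   the other two are evaluated. *)
transitivity (\sum_(x <- D) cor k x * (cor h x * cor l x)).
  by apply: eq_bigr => x _; ring.
rewrite sum_cor.
transitivity (\sum_(c <- A) \sum_(p <- A) \sum_(q <- A)
    \sum_(c' <- A) \sum_(p' <- A) \sum_(q' <- A)
    (m (c, (p, q)) == m (c', (p', q')))%:R
      * (h c * k p * l q * (h c' * k p' * l q'))); last first.
  rewrite big_allpairs_dep; apply: eq_bigr => c _.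
  rewrite big_allpairs_dep; apply: eq_bigr => p _; apply: eq_bigr => q _.
  rewrite big_allpairs_dep; apply: eq_bigr => c' _.
  by rewrite big_allpairs_dep.
rewrite [RHS]exchange_big; apply: eq_bigr => p _ /=.
transitivity (\sum_(c <- A) \sum_(q <- A) \sum_(p' <- A)
    \sum_(c' <- A) \sum_(q' <- A)
    (m (c, (p, q)) == m (c', (p', q')))%:R
      * (h c * k p * l q * (h c' * k p' * l q'))); last first.
  by apply: eq_bigr => c _; apply: eq_bigr => q _; rewrite exchange_big.
under [RHS]eq_bigr do rewrite exchange_big.
rewrite [RHS]exchange_big; apply: eq_bigr => p' _ /=.
rewrite -hsg {1}/cor mulrC mulr_suml mulr_suml; apply: eq_bigr => c _.
rewrite [RHS]exchange_big /= mulr_suml mulr_suml; apply: eq_bigr => c' _.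
rewrite mulrAC mulr_sumr; apply: eq_bigr => q _.
rewrite mulr_sumr; apply: eq_bigr => q' _.
have -> : (m (c, (p, q)) == m (c', (p', q')))
    = (sg c - sg c' == p' - p) && (q' - q == p' - p).
  rewrite /m xpair_eqE /= andbC; congr (_ && _).
    by rewrite -subr_eq0 -[in RHS]subr_eq0 opprD opprB addrACA.
  rewrite -subr_eq0 -[in RHS]subr_eq0 -[in RHS]oppr_eq0; congr (_ == _).
  by rewrite !opprB [RHS]addrC addrACA [RHS]addrACA [- q' + _]addrC.
by rewrite -mulnb natrM; ring.
Qed.


Local Notation n := ((#|` A|)%:R : R).
Local Notation sd := (fun p => Num.sqrt (deg p)).

(** The case [s = 0] of the Katz-Koester bound, where X_0 = X and every [p] is admissible. *)
Lemma card_ge_sum_invdeg : n ^+ 2 * \sum_(p <- A) (deg p)^-1 <= (#|` X|)%:R.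
Proof.
have [_ hX] := sgX; rewrite -(rep0 X); apply: (rep_ge_sum_invdeg 0 0 predT) => c p cA pA _.
by rewrite !addr0 andbb hX.
Qed.

(** Only the middle weight is [deg] to the power -1/2, and v_s = |A_s|. Summing over [q] gives
    [deg p], hence [n * Z] on the left. The correlation factor contains a single f o f, which is at
    most n_s / n^2, so it is at most F / n^2 and the right side becomes F^2 / n^2. *)
Lemma energy3_ge_sum_sqrt_deg : n ^+ 2 * \sum_(p <- A) sd p <= (energy3 X A)%:R.
Proof.
set Z := \sum_(p <- A) _.
have Z0 : 0 <= Z by apply: sumr_ge0 => p _; apply: sqrtr_ge0.
have EF : (energy3 X A)%:R = \sum_(s <- D) (rep X s)%:R * (rep A s)%:R ^+ 2 :> R.
  by rewrite /energy3 natr_sum; apply: eq_bigr => s _; rewrite natrM natrX.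
have := cauchy_schwarz_triple (fun=> 1) (fun p => (sd p)^-1) (fun=> 1)
          (fun s => (rep A s)%:R).
have -> : \sum_(c <- A) \sum_(p <- A) \sum_(q <- A)
    1 * (sd p)^-1 * 1 * (rep A (q - p))%:R = n * Z.
  rewrite card_sum1 mulr_suml; apply: eq_bigr => c _; rewrite mul1r.
  apply: eq_big_seq => p pA; rewrite -mulr_sumr !mul1r mulr1 -/(deg p).
  have d0 := deg_ge0 p; rewrite -{2}(sqr_sqrtr d0) expr2 mulrA mulVf ?mul1r //.
  by rewrite gt_eqF // sqrtr_gt0 deg_gt0.
rewrite -EF; set F := (energy3 X A)%:R; set Q := (X in _ <= _ * X).
have QF : n ^+ 2 * Q <= F.
  rewrite mulr_sumr /F EF; apply: ler_sum => s _.
  rewrite -!rep_cor1 [leLHS](_ : _ = n ^+ 2 * cor (fun p => (sd p)^-1) s * (rep A s)%:R ^+ 2); last by ring.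
  by rewrite ler_wpM2r ?sqr_ge0 ?rep_ge_cor_deg.
move=> h.
rewrite -ler_sqr ?nnegrE ?mulr_ge0 ?sqr_ge0 ?ler0n //.
rewrite [leLHS](_ : _ = n ^+ 2 * (n * Z) ^+ 2); last by ring.
apply: le_trans (ler_wpM2l (sqr_ge0 n) h) _.
by rewrite mulrCA [leRHS]expr2 ler_wpM2l.
Qed.

Lemma energyP_sum : (energyP 3 D X)%:R = \sum_(s <- D) (rep X s)%:R ^+ 3 :> R.
Proof. by rewrite /energyP natr_sum; apply: eq_bigr => s _; rewrite natrX. Qed.

(** The term at [s = 0] suffices, as X_0 = X. *)
Lemma card_cube_le_energyP : A != fset0 -> (#|` X|)%:R ^+ 3 <= (energyP 3 D X)%:R :> R.
Proof.
move=> /fset0Pn[a aA]; rewrite energyP_sum.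
have D0 : 0 \in D by rewrite -(subrr a) mem_diffset.
rewrite (bigD1_seq 0) ?fset_uniq //= rep0 lerDl.
by apply: sumr_ge0 => s _; rewrite exprn_ge0.
Qed.

(** All three weights are [deg] to the power -1/2 and v = 1. With N the sum of n_s over [D], this
    gives n^6 Y^6 <= N G. Cubing and Hoelder's N^3 <= G |D|^2 conclude. *)
Lemma energyP_ge_sum_invsqrt_deg :
  n ^+ 18 * (\sum_(p <- A) (sd p)^-1) ^+ 18
    <= (energyP 3 D X)%:R ^+ 4 * (#|` D|)%:R ^+ 2.
Proof.
set Y := \sum_(p <- A) _.
have f0 p : 0 <= (sd p)^-1 by rewrite invr_ge0 sqrtr_ge0.
have Y0 : 0 <= Y by apply: sumr_ge0.
have := hoelder_cube_sum R _ D (fun s => (rep X s)%:R) (fun=> 1)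
  (fun s => ler0n _ _) (fun=> ler01).
rewrite -energyP_sum.
have -> : \sum_(s <- D) (1 : R) ^+ 3 = (#|` D|)%:R.
  by rewrite card_sum1; apply: eq_bigr => s _; rewrite expr1n.
have := cauchy_schwarz_triple (fun p => (sd p)^-1) (fun p => (sd p)^-1)
  (fun p => (sd p)^-1) (fun=> 1).
have -> : \sum_(c <- A) \sum_(p <- A) \sum_(q <- A)
    (sd c)^-1 * (sd p)^-1 * (sd q)^-1 * 1 = Y ^+ 3.
  rewrite !exprS expr0 mulr1 mulr_suml; apply: eq_bigr => c _.
  rewrite mulr_suml mulr_sumr; apply: eq_bigr => p _.
  by rewrite !mulr_sumr; apply: eq_bigr => q _; ring.
have N0 : 0 <= \sum_(s <- D) (rep X s)%:R * 1 ^+ 2 :> R.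
  by apply: sumr_ge0 => s _; rewrite expr1n mulr1.
have QG : n ^+ 6 * \sum_(x <- D) cor (fun p => (sd p)^-1) x
    * cor (fun p => (sd p)^-1) x * cor (fun p => (sd p)^-1) x <= (energyP 3 D X)%:R.
  rewrite energyP_sum mulr_sumr; apply: ler_sum => s _.
  rewrite [leLHS](_ : _ = (n ^+ 2 * cor (fun p => (sd p)^-1) s) ^+ 3); last by ring.
  by rewrite lerXn2r ?nnegrE ?mulr_ge0 ?sqr_ge0 ?cor_ge0 ?rep_ge_cor_deg ?ler0n.
move: N0 QG; set Q := \sum_(x <- D) cor _ _ * _ * _; set N := \sum_(s <- D) _ * _.
set G := (energyP 3 D X)%:R => N0 QG h1 h2.
have G0 : 0 <= G :> R by rewrite ler0n.
have h3 : n ^+ 6 * Y ^+ 6 <= N * G.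
  rewrite [X in _ * X](_ : _ = (Y ^+ 3) ^+ 2); last by rewrite -exprM.
  apply: le_trans (ler_wpM2l (exprn_ge0 6 (ler0n _ _)) h1) _.
  by rewrite mulrCA ler_wpM2l.
rewrite [leLHS](_ : _ = (n ^+ 6 * Y ^+ 6) ^+ 3); last by ring.
apply: (@le_trans _ _ ((N * G) ^+ 3)).
  by rewrite lerXn2r ?nnegrE ?mulr_ge0 ?exprn_ge0.
rewrite exprMn [leRHS](_ : _ = G * (#|` D|)%:R ^+ 2 * G ^+ 3); last by ring.
by rewrite ler_wpM2r ?exprn_ge0.
Qed.

(** * Subsets of [A] on which the degree is bounded *)

Section RegularSubset.
Variables (B : {fset T}) (M : R).
Hypotheses (sBA : (B `<=` A)%fset) (M0 : 0 < M).
Hypothesis degB : forall p, p \in B -> deg p <= M.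
Local Notation G := ((energyP 3 D X)%:R : R).

(** For [p], [q] in [B] the weight [(sd p * sd q)^-1] is at least [1 / M], so M (f o f) dominates
    the correlation of the indicator of [B]. *)
Lemma rep_regular_le s : n ^+ 2 * (rep B s)%:R <= M * (rep X s)%:R.
Proof.
apply: le_trans (ler_wpM2l (ltW M0) (rep_ge_cor_deg s)).
rewrite mulrCA ler_wpM2l ?sqr_ge0 // rep_cor // /cor mulr_sumr.
rewrite big_seq [leRHS]big_seq; apply: ler_sum => p pA.
rewrite mulr_sumr big_seq [leRHS]big_seq; apply: ler_sum => q qA.
rewrite [leRHS]mulrCA ler_wpM2l //.
have Vge0 : 0 <= M * ((sd p)^-1 * (sd q)^-1).
  by rewrite !mulr_ge0 ?invr_ge0 ?sqrtr_ge0 // ltW.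
have [pB|pB] := boolP (p \in B); last by rewrite mul0r.
have [qB|qB] := boolP (q \in B); last by rewrite mulr0.
rewrite mulr1 -invfM ler_pdivlMr ?mulr_gt0 ?sqrtr_gt0 ?deg_gt0 // mul1r.
rewrite -[leRHS](sqr_sqrtr (ltW M0)) expr2.
by apply: ler_pM; rewrite ?sqrtr_ge0 //; apply: ler_wsqrtr; apply: degB.
Qed.

(** All three weights are the indicator of [B]; the sum of |B_s|^3 that results is controlled by the
    cube of the pointwise bound. *)
Lemma cauchy_schwarz_regular (v : T -> R) :
  n ^+ 6 * ((#|` B|)%:R * \sum_(s <- D) (rep B s)%:R * v s) ^+ 2
    <= (\sum_(s <- D) (rep X s)%:R * v s ^+ 2) * (M ^+ 3 * G).
Proof.
pose iB p : R := (p \in B)%:R.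
have := cauchy_schwarz_triple iB iB iB v.
have -> : \sum_(c <- A) \sum_(p <- A) \sum_(q <- A) iB c * iB p * iB q * v (q - p)
    = (#|` B|)%:R * \sum_(s <- D) (rep B s)%:R * v s.
  transitivity ((\sum_(c <- A) iB c) * \sum_(p <- A) \sum_(q <- A) iB p * iB q * v (q - p)).
    rewrite mulr_suml; apply: eq_bigr => c _.
    rewrite mulr_sumr; apply: eq_bigr => p _.
    by rewrite mulr_sumr; apply: eq_bigr => q _; ring.
  rewrite -sum_cor; congr (_ * _); last by apply: eq_bigr => s _; rewrite rep_cor.
  by rewrite card_sum1 (sum_subset B) //; apply: eq_bigr => p _; rewrite mulr1.
have QG : n ^+ 6 * (\sum_(x <- D) cor iB x * cor iB x * cor iB x) <= M ^+ 3 * G.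
  rewrite energyP_sum !mulr_sumr; apply: ler_sum => s _; rewrite -rep_cor //.
  rewrite [leLHS](_ : _ = (n ^+ 2 * (rep B s)%:R) ^+ 3); last by ring.
  rewrite -exprMn lerXn2r ?nnegrE ?mulr_ge0 ?sqr_ge0 ?ler0n ?rep_regular_le //.
  exact: ltW.
move=> h; apply: le_trans (ler_wpM2l (exprn_ge0 6 (ler0n _ _)) h) _.
rewrite mulrCA ler_wpM2l //.
by apply: sumr_ge0 => s _; rewrite mulr_ge0 ?sqr_ge0.
Qed.

Lemma diffset_sub : (diffset B B `<=` D)%fset.
Proof.
apply/fsubsetP => x /imfset2P[p pB [q qB ->]].
by rewrite mem_diffset //; apply: (fsubsetP sBA).
Qed.

(** Moves the sum to the common range [D]. The added terms are powers of 0, which vanish for a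
    nonzero exponent while 0 to the power 0 is 1. *)
Lemma energyR_sum (al : R) : al != 0 ->
  energyR al B = \sum_(s <- D) (rep B s)%:R `^ al.
Proof.
move=> al0; apply: big_fset_incl; first exact: diffset_sub.
by move=> s _ sB; rewrite rep_eq0 // powR0.
Qed.

Lemma energyR2_sum : energyR 2 B = \sum_(s <- D) (rep B s)%:R ^+ 2 :> R.
Proof.
by rewrite energyR_sum ?pnatr_eq0 //; apply: eq_bigr => s _; rewrite powR_mulrn.
Qed.

Lemma energyR32_sum :
  energyR (3 / 2) B = \sum_(s <- D) Num.sqrt (rep B s)%:R ^+ 3 :> R.
Proof.
rewrite energyR_sum ?mulf_neq0 ?invr_eq0 ?pnatr_eq0 //; apply: eq_bigr => s _.
by rewrite mulrC powRrM powR12_sqrt // powR_mulrn ?sqrtr_ge0.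
Qed.

(** The choice v_s = |B_s|; the pointwise bound, used twice, estimates the sum of n_s |B_s|^2 by M^2
    G / n^4. *)
Lemma energyP_ge_energyR2 :
  n ^+ 10 * (#|` B|)%:R ^+ 2 * energyR 2 B ^+ 2 <= M ^+ 5 * G ^+ 2.
Proof.
have := cauchy_schwarz_regular (fun s => (rep B s)%:R).
rewrite energyR2_sum; under eq_bigr do rewrite -expr2.
set W := \sum_(s <- D) _ ^+ 2; set N := \sum_(s <- D) _ * _ => h.
have NG : n ^+ 4 * N <= M ^+ 2 * G.
  rewrite energyP_sum !mulr_sumr; apply: ler_sum => s _.
  rewrite [leLHS](_ : _ = (rep X s)%:R * (n ^+ 2 * (rep B s)%:R) ^+ 2); last by ring.
  rewrite [leRHS](_ : _ = (rep X s)%:R * (M * (rep X s)%:R) ^+ 2); last by ring.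
  rewrite ler_wpM2l // lerXn2r ?nnegrE ?mulr_ge0 ?sqr_ge0 ?ler0n ?rep_regular_le //.
  exact: ltW.
rewrite [leLHS](_ : _ = n ^+ 4 * (n ^+ 6 * ((#|` B|)%:R * W) ^+ 2)); last by ring.
apply: le_trans (ler_wpM2l (exprn_ge0 4 (ler0n _ _)) h) _.
rewrite [leLHS]mulrA [leRHS](_ : _ = M ^+ 2 * G * (M ^+ 3 * G)); last by ring.
by rewrite ler_wpM2r // mulr_ge0 ?ler0n // exprn_ge0 // ltW.
Qed.

(** The choice v_s = |B_s|^(1/2). Hoelder bounds the cube of the sum N of n_s |B_s| by G W^2, with W
    the 3/2-energy of [B]; after cubing the Cauchy-Schwarz bound, W^2 cancels. *)
Lemma energyP_ge_energyR32 :
  n ^+ 18 * (#|` B|)%:R ^+ 6 * energyR (3 / 2) B ^+ 4 <= M ^+ 9 * G ^+ 4.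
Proof.
have := cauchy_schwarz_regular (fun s => Num.sqrt (rep B s)%:R).
have := hoelder_cube_sum R _ D (fun s => (rep X s)%:R)
  (fun s => Num.sqrt (rep B s)%:R) (fun s => ler0n _ _) (fun s => sqrtr_ge0 _).
rewrite -energyP_sum energyR32_sum.
have -> : \sum_(s <- D) (rep B s)%:R * Num.sqrt (rep B s)%:R
    = \sum_(s <- D) Num.sqrt (rep B s)%:R ^+ 3 :> R.
  by apply: eq_bigr => s _; rewrite [RHS]exprSr sqr_sqrtr.
have : 0 <= \sum_(s <- D) Num.sqrt (rep B s)%:R ^+ 3 :> R.
  by apply: sumr_ge0 => s _; rewrite exprn_ge0 ?sqrtr_ge0.
set W := \sum_(s <- D) _ ^+ 3; set N := \sum_(s <- D) _ * _ => W0 h1 h2.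
have G0 : 0 <= G by rewrite ler0n.
have N0 : 0 <= N by apply: sumr_ge0 => s _; rewrite mulr_ge0 ?sqr_ge0.
have [->|Wn0] := eqVneq W 0.
  by rewrite expr0n mulr0 mulr_ge0 ?exprn_ge0 // ltW.
have Wp : 0 < W ^+ 2 by rewrite exprn_gt0 // lt_neqAle eq_sym Wn0.
rewrite -(ler_pM2r Wp).
rewrite [leLHS](_ : _ = (n ^+ 6 * ((#|` B|)%:R * W) ^+ 2) ^+ 3); last by ring.
apply: (@le_trans _ _ ((N * (M ^+ 3 * G)) ^+ 3)).
  rewrite lerXn2r // nnegrE; last by rewrite mulr_ge0 ?mulr_ge0 ?exprn_ge0 // ltW.
  by rewrite mulr_ge0 ?sqr_ge0 // exprn_ge0.
rewrite exprMn [leRHS](_ : _ = G * W ^+ 2 * (M ^+ 3 * G) ^+ 3); last by ring.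
by rewrite ler_wpM2r // exprn_ge0 // mulr_ge0 // exprn_ge0 // ltW.
Qed.

End RegularSubset.
End Model.
End Correlation.

(** * Logarithms of naturals and rational powers *)

Lemma log2_natr (R : realType) (k : nat) :
  (0 < k)%N -> log2 (k%:R : R) = 0 \/ 1 <= log2 (k%:R : R).
Proof.
(* The value 0 comes from [k = 1]; from [k = 2] on the logarithm is at least that of 2. *)
case: k => [//|[|k]] _; first by left; rewrite /log2 ln1 mul0r.
right; have l2 : 0 < ln (2 : R) by rewrite ln_gt0 ?ltr1n.
by rewrite /log2 ler_pdivlMr // mul1r ler_ln ?posrE ?ltr0n // ler_nat.
Qed.

(* At [L = 0] the quotient on the left is [0] by convention. *)
Lemma div_mul_le (R : realType) (a b c L : R) :
  0 <= a -> 0 < b -> L = 0 \/ 1 <= L -> 0 <= c -> a <= c * b -> a / (b * L) <= c.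
Proof.
move=> a0 b0 [->|L1] c0 acb; first by rewrite mulr0 invr0 mulr0.
rewrite ler_pdivrMr ?mulr_gt0 //; last exact: lt_le_trans ltr01 L1.
rewrite mulrA; apply: le_trans acb _.
by rewrite ler_peMr // mulr_ge0 // ltW.
Qed.

(** Clears the fractional exponents when both sides of a bound are raised to the power [m]. *)
Lemma powR_frac (R : realType) (x : R) (k m : nat) :
  0 <= x -> (0 < m)%N -> (x `^ (k%:R / m%:R)) ^+ m = x ^+ k.
Proof.
move=> x0 m0; rewrite -powR_mulrn ?powR_ge0 // -powRrM divfK ?powR_mulrn //.
by rewrite pnatr_eq0 -lt0n.
Qed.

(** * Relations between the degree sums, and the unconditional bounds *)

Section LowerBounds.
Variables (R : realType) (T : zmodType) (A : {fset T}).
Hypothesis A0 : A != fset0.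
Local Notation D := (diffset A A).
Local Notation n := ((#|` A|)%:R : R).
Local Notation E := ((energy A)%:R : R).
Local Notation d := (deg R T A).
Local Notation sd := (fun p => Num.sqrt (d p)).
Local Notation Z := (\sum_(p <- A) Num.sqrt (d p)).
Local Notation Y := (\sum_(p <- A) (Num.sqrt (d p))^-1).
Local Notation H := (\sum_(p <- A) (d p)^-1).

Lemma card_gt0 : 0 < n.
Proof. by rewrite ltr0n cardfs_gt0. Qed.

Lemma sqrt_deg_gt0 p : p \in A -> 0 < Num.sqrt (d p).
Proof. by move=> pA; rewrite sqrtr_gt0 deg_gt0. Qed.

Lemma energy_gt0 : 0 < E.
Proof.
rewrite -sum_deg; have /fset0Pn[a aA] := A0.
rewrite (bigD1_seq a) ?fset_uniq //= ltr_pwDl ?deg_gt0 //.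
by apply: sumr_ge0 => p _; apply: deg_ge0.
Qed.

Lemma sum_sqrt_deg_gt0 : 0 < Z.
Proof.
have /fset0Pn[a aA] := A0.
rewrite (bigD1_seq a) ?fset_uniq //= ltr_pwDl ?sqrt_deg_gt0 //.
by apply: sumr_ge0 => p _; apply: sqrtr_ge0.
Qed.

Lemma card_sqr_le_sum_sqrt : n ^+ 2 <= Z * Y.
Proof.
rewrite card_sum1; apply: sum_mul_sum_inv => [p|p]; first exact: sqrtr_ge0.
exact: sqrt_deg_gt0.
Qed.

Lemma card_sqr_le_energy : n ^+ 2 <= E * H.
Proof.
rewrite card_sum1 -sum_deg; apply: sum_mul_sum_inv => [p|p]; first exact: deg_ge0.
exact: deg_gt0.
Qed.

Lemma sum_invsqrt_deg_sqr : Y ^+ 2 <= n * H.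
Proof.
rewrite card_sum1; apply: le_trans (sum_le_sum_sqr _ _ _ _) _.
rewrite ler_wpM2l ?sumr_ge0 // le_eqVlt; apply/orP; left; apply/eqP.
by apply: eq_bigr => p _; rewrite exprVn sqr_sqrtr ?deg_ge0.
Qed.

Lemma sum_sqrt_deg_sqr : Z ^+ 2 <= n * E.
Proof.
rewrite card_sum1 -sum_deg; apply: le_trans (sum_le_sum_sqr _ _ _ _) _.
rewrite ler_wpM2l ?sumr_ge0 // le_eqVlt; apply/orP; left; apply/eqP.
by apply: eq_bigr => p _; rewrite sqr_sqrtr ?deg_ge0.
Qed.

(** Markov's inequality: at most half of [A] can carry values above twice the mean. *)
Lemma card_sublevel_ge (g : T -> R) : (forall p, 0 <= g p) ->
  0 < \sum_(p <- A) g p ->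
  n <= 2 * (#|` [fset p in A | g p <= 2 * (\sum_(q <- A) g q) / n]%fset|)%:R.
Proof.
move=> g0; set S := \sum_(q <- A) g q => S0; set B := [fset p in A | _]%fset.
have n0 := card_gt0.
have sBA : (B `<=` A)%fset by apply/fsubsetP => p; rewrite !inE => /andP[].
have gK p : p \in A -> p \notin B -> 2 * S / n <= g p.
  by move=> pA; rewrite !inE pA /= -ltNge => /ltW.
move: gK; set K := 2 * S / n => gK.
have le1 : n * K - (#|` B|)%:R * K <= S.
  rewrite !card_sum1 (sum_subset R T A B) // -mulrBl -sumrB mulr_suml /S.
  rewrite big_seq [leRHS]big_seq; apply: ler_sum => p pA; rewrite mulr1.
  have [pB|pB] := boolP (p \in B); first by rewrite subrr mul0r.
  by rewrite subr0 mul1r gK.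
move: le1; rewrite /K -mulrBl mulrA ler_pdivrMr // mulrA [S * _]mulrC ler_pM2r //.
by rewrite mulrBl; lra.
Qed.

Section Model.
Variables (sg : T -> T) (X : {fset T}).
Hypothesis sgX : sum_model R T A sg X.
Local Notation F := ((energy3 X A)%:R : R).
Local Notation G := ((energyP 3 D X)%:R : R).

(** From F >= n^2 Z and |D| >= n^2 H, the product F^2 |D|^2 E is at least n^8 (Z^2 H) (E H), and the
    two brackets are at least n^3 and n^2. *)
Lemma energy3_lower : n ^+ 13 / ((#|` D|)%:R ^+ 2 * E) <= F ^+ 2.
Proof.
have n0 := card_gt0; have E0 := energy_gt0; have Z0 := sum_sqrt_deg_gt0.
have h1 := energy3_ge_sum_sqrt_deg _ _ _ _ _ sgX.
(* The cardinality in the bound is that of [D] for either choice of [X], hence the difference model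
   here. *)
have h2 := card_ge_sum_invdeg _ _ _ _ _ (sum_model_diffset R T A).
have H0 : 0 < H.
  by rewrite -(pmulr_rgt0 _ E0); apply: lt_le_trans card_sqr_le_energy; rewrite exprn_gt0.
have ZH : n ^+ 3 <= Z ^+ 2 * H.
  rewrite -(ler_pM2l n0) -exprS (_ : n ^+ 4 = (n ^+ 2) ^+ 2); last by rewrite -exprM.
  apply: (@le_trans _ _ ((Z * Y) ^+ 2)).
    rewrite lerXn2r ?card_sqr_le_sum_sqrt // nnegrE ?sqr_ge0 //.
    exact: le_trans (sqr_ge0 _) card_sqr_le_sum_sqrt.
  by rewrite exprMn [leRHS]mulrCA ler_wpM2l ?sqr_ge0 ?sum_invsqrt_deg_sqr.
have D0 : 0 < (#|` D|)%:R :> R.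
  by apply: lt_le_trans h2; rewrite mulr_gt0 ?exprn_gt0.
rewrite ler_pdivrMr; last by rewrite mulr_gt0 ?exprn_gt0.
apply: (@le_trans _ _ ((n ^+ 2 * Z) ^+ 2 * ((n ^+ 2 * H) ^+ 2 * E))).
  rewrite [leRHS](_ : _ = n ^+ 8 * ((Z ^+ 2 * H) * (E * H))); last by ring.
  rewrite (_ : n ^+ 13 = n ^+ 8 * (n ^+ 3 * n ^+ 2)); last by rewrite -!exprD.
  rewrite ler_wpM2l ?exprn_ge0 ?ler0n //.
  by rewrite ler_pM ?exprn_ge0 ?ler0n ?card_sqr_le_energy.
have F0 : 0 <= n ^+ 2 * Z by rewrite mulr_ge0 ?exprn_ge0 // ltW.
have DH0 : 0 <= n ^+ 2 * H by rewrite mulr_ge0 ?exprn_ge0 // ltW.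
apply: ler_pM; [exact: sqr_ge0 | by apply: mulr_ge0; rewrite ?sqr_ge0 ?ler0n | |].
  by rewrite lerXn2r ?nnegrE.
by rewrite ler_wpM2r ?ler0n // lerXn2r ?nnegrE.
Qed.

(** The first term comes from [s = 0]. For the second, n^4 <= Z^2 Y^2 and Z^2 <= n E give Y^2 E >=
    n^3, whose ninth power is inserted into the bound by Y^18. *)
Lemma energyP_lower :
  Num.max ((#|` X|)%:R ^+ 12) (n ^+ 45 / (E ^+ 9 * (#|` D|)%:R ^+ 2)) <= G ^+ 4.
Proof.
have n0 := card_gt0; have E0 := energy_gt0; have Z0 := sum_sqrt_deg_gt0.
rewrite ge_max; apply/andP; split.
  rewrite (_ : _ ^+ 12 = ((#|` X|)%:R ^+ 3) ^+ 4); last by rewrite -exprM.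
  by rewrite lerXn2r ?nnegrE ?exprn_ge0 ?ler0n ?card_cube_le_energyP.
have D0 : 0 < (#|` D|)%:R :> R.
  rewrite ltr0n cardfs_gt0; apply/fset0Pn; have /fset0Pn[a aA] := A0.
  by exists (a - a); apply: mem_diffset.
have YE : n ^+ 3 <= Y ^+ 2 * E.
  rewrite -(ler_pM2l n0) -exprS (_ : n ^+ 4 = (n ^+ 2) ^+ 2); last by rewrite -exprM.
  apply: (@le_trans _ _ ((Z * Y) ^+ 2)).
    rewrite lerXn2r ?card_sqr_le_sum_sqrt // nnegrE ?sqr_ge0 //.
    exact: le_trans (sqr_ge0 _) card_sqr_le_sum_sqrt.
  by rewrite exprMn mulrC [leRHS]mulrCA ler_wpM2l ?sqr_ge0 ?sum_sqrt_deg_sqr.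
rewrite ler_pdivrMr; last by rewrite mulr_gt0 ?exprn_gt0.
apply: (@le_trans _ _ (E ^+ 9 * (n ^+ 18 * Y ^+ 18))).
  rewrite [leRHS](_ : _ = n ^+ 18 * (Y ^+ 2 * E) ^+ 9); last by ring.
  rewrite (_ : n ^+ 45 = n ^+ 18 * (n ^+ 3) ^+ 9); last by rewrite -exprM -exprD.
  rewrite ler_wpM2l ?exprn_ge0 ?ler0n // lerXn2r // nnegrE ?exprn_ge0 ?ler0n //.
  by rewrite mulr_ge0 ?sqr_ge0 ?ler0n.
rewrite [leRHS]mulrCA ler_wpM2l ?exprn_ge0 ?ler0n //.
exact: energyP_ge_sum_invsqrt_deg sgX.
Qed.

(** * Bounds for connected sets *)

Section Connected.
Variables beta gamma : R.
Hypotheses (beta2 : beta <= 1 / 2) (gamma0 : 0 <= gamma).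

(** A subset with at least half of the elements qualifies because [beta <= 1 / 2], and its density
    factor is at least 2^(-k). Integrality of [2 * al] turns the real power into an ordinary one. *)
Lemma connected_half (k : nat) (al : R) (B : {fset T}) :
  2 * al = k%:R -> connected al beta gamma A -> (B `<=` A)%fset ->
  n <= 2 * (#|` B|)%:R -> gamma * energyR al A <= 2 ^+ k * energyR al B.
Proof.
move=> alk conn sBA nB; have n0 := card_gt0.
have bB : beta * n <= (#|` B|)%:R.
  by apply: le_trans (ler_wpM2r (ltW n0) beta2) _; lra.
have := conn B sBA bB; rewrite alk powR_mulrn ?divr_ge0 // => h.
have hB : 1 <= 2 ^+ k * ((#|` B|)%:R / n) ^+ k.
  by rewrite -exprMn exprn_ege1 // mulrA ler_pdivlMr // mul1r.
apply: le_trans (ler_wpM2l (exprn_ge0 k (ler0n R 2)) h).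
have gE : 0 <= gamma * energyR al A.
  by rewrite mulr_ge0 // sumr_ge0 // => s _; apply: powR_ge0.
by have := ler_wpM2r gE hB; rewrite mul1r; congr (_ <= _); ring.
Qed.

Lemma energy3_connected : connected 2 beta gamma A ->
  gamma * n ^+ 5 * E <= 32 * F ^+ 2.
Proof.
move=> conn; have n0 := card_gt0; have Z0 := sum_sqrt_deg_gt0.
pose B := [fset p in A | sd p <= 2 * Z / n]%fset.
have sBA : (B `<=` A)%fset by apply/fsubsetP => p; rewrite !inE => /andP[].
have nB : n <= 2 * (#|` B|)%:R.
  by apply: (card_sublevel_ge sd) => // p; apply: sqrtr_ge0.
have h1 := connected_half 4 2 B (esym (natrM _ 2 2)) conn sBA nB.
(* One factor |B_s| is enlarged to |A_s|, then [q] is allowed to run over [A]: each [p] in [B]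
   contributes at most [d p], that is [sd p] squared, and one [sd p] is bounded by the threshold. *)
have EB : energyR 2 B <= 2 * Z / n * Z.
  rewrite (energyR2_sum _ _ A) //.
  apply: (@le_trans _ _ (\sum_(s <- D) cor R T A (fun p => (p \in B)%:R) s * (rep A s)%:R)).
    apply: ler_sum => s _; rewrite expr2 -rep_cor // ler_wpM2l // ler_nat.
    exact: rep_sub.
  rewrite sum_cor mulr_sumr big_seq [leRHS]big_seq; apply: ler_sum => p pA.
  have [pB|pB] := boolP (p \in B); last first.
    rewrite big1 ?mulr_ge0 ?invr_ge0 ?sqrtr_ge0 ?ltW // => q _.
    by rewrite !mul0r.
  apply: (@le_trans _ _ (d p)).
    by apply: ler_sum => q _; rewrite mul1r; case: (q \in B); rewrite ?mul1r ?mul0r.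
  rewrite -[leLHS](sqr_sqrtr (deg_ge0 _ _ _ _)) expr2 ler_wpM2r ?sqrtr_ge0 //.
  by move: pB; rewrite !inE => /andP[].
have EA : energyR 2 A = E.
  by rewrite (energyR2_sum _ _ A) // /energy natr_sum; apply: eq_bigr => s _; rewrite natrX.
rewrite EA in h1.
(* Here 32 is 2^4 from connectedness times 2 from the threshold. *)
have h2 : gamma * E * n <= 32 * Z ^+ 2.
  have := le_trans h1 (ler_wpM2l (exprn_ge0 4 (ler0n R 2)) EB).
  rewrite [X in _ <= X -> _](_ : _ = 32 * Z ^+ 2 / n); last by ring.
  by rewrite ler_pdivlMr.
have h3 := energy3_ge_sum_sqrt_deg _ _ _ _ _ sgX.
have h4 : (n ^+ 2 * Z) ^+ 2 <= F ^+ 2.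
  by rewrite lerXn2r ?nnegrE ?mulr_ge0 ?exprn_ge0 ?ler0n // ltW.
have := ler_wpM2l (exprn_ge0 4 (ltW n0)) h2.
by move: h4; rewrite exprMn -exprM; nra.
Qed.

(** The threshold is twice the mean of [d], so Markov keeps at least half of [A]. *)
Definition regular_part : {fset T} := [fset p in A | d p <= 2 * E / n]%fset.

Lemma regular_part_sub : (regular_part `<=` A)%fset.
Proof. by apply/fsubsetP => p; rewrite !inE => /andP[]. Qed.

Lemma regular_part_deg p : p \in regular_part -> d p <= 2 * E / n.
Proof. by rewrite !inE => /andP[]. Qed.

Lemma card_regular_part : n <= 2 * (#|` regular_part|)%:R.
Proof.
rewrite /regular_part -sum_deg; apply: card_sublevel_ge; first exact: deg_ge0.
by rewrite sum_deg energy_gt0.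
Qed.

(** Take M = 2 E / n, b >= n / 2 and W >= gamma E / 16 in the bound for regular subsets. The
    constant is 2^5 2^2 2^8, and E^2 cancels. *)
Lemma energyP_connected2 : connected 2 beta gamma A ->
  gamma ^+ 2 * n ^+ 17 <= 2 ^+ 15 * E ^+ 3 * G ^+ 2.
Proof.
move=> conn; have n0 := card_gt0; have E0 := energy_gt0.
have M0 : 0 < 2 * E / n by rewrite divr_gt0 ?mulr_gt0.
have nB := card_regular_part.
have h1 := connected_half 4 2 _ (esym (natrM _ 2 2)) conn regular_part_sub nB.
have EA : energyR 2 A = E.
  by rewrite (energyR2_sum _ _ A) // /energy natr_sum; apply: eq_bigr => s _; rewrite natrX.
rewrite EA in h1.
have := energyP_ge_energyR2 _ _ _ _ _ sgX _ _ regular_part_sub M0 regular_part_deg.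
set W := energyR 2 _ in h1 *; set b := (#|` regular_part|)%:R in nB *.
rewrite expr_div_n [X in _ <= X -> _]mulrAC ler_pdivlMr ?exprn_gt0 // => h2.
have h3 : n ^+ 2 <= (2 * b) ^+ 2 by rewrite lerXn2r ?nnegrE ?mulr_ge0 ?ler0n.
have W0 : 0 <= W by apply: sumr_ge0 => s _; apply: powR_ge0.
have h4 : (gamma * E) ^+ 2 <= (2 ^+ 4 * W) ^+ 2.
  by rewrite lerXn2r ?nnegrE ?mulr_ge0 ?exprn_ge0 ?ler0n // ltW.
have h5 : n ^+ 2 * (gamma * E) ^+ 2 <= (2 * b) ^+ 2 * (2 ^+ 4 * W) ^+ 2.
  by rewrite ler_pM ?sqr_ge0.
rewrite -(ler_pM2l (exprn_gt0 2 E0)).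
have := ler_wpM2l (exprn_ge0 15 (ltW n0)) h5.
rewrite (_ : n ^+ 15 * (n ^+ 2 * (gamma * E) ^+ 2) = E ^+ 2 * (gamma ^+ 2 * n ^+ 17)); last by ring.
move/le_trans; apply.
rewrite [leLHS](_ : _ = 2 ^+ 10 * (n ^+ 10 * b ^+ 2 * W ^+ 2 * n ^+ 5)); last by ring.
rewrite [leRHS](_ : _ = 2 ^+ 10 * ((2 * E) ^+ 5 * G ^+ 2)); last by ring.
by rewrite ler_wpM2l ?exprn_ge0.
Qed.

(** The same substitution with W >= gamma V / 8; the constant is 2^9 2^6 2^12. *)
Lemma energyP_connected32 : connected (3 / 2) beta gamma A ->
  gamma ^+ 4 * n ^+ 33 * energyR (3 / 2) A ^+ 4 <= 2 ^+ 27 * E ^+ 9 * G ^+ 4.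
Proof.
move=> conn; have n0 := card_gt0; have E0 := energy_gt0.
have M0 : 0 < 2 * E / n by rewrite divr_gt0 ?mulr_gt0.
have nB := card_regular_part.
have a3 : 2 * (3 / 2) = 3%:R :> R by lra.
have h1 := connected_half 3 (3 / 2) _ a3 conn regular_part_sub nB.
have := energyP_ge_energyR32 _ _ _ _ _ sgX _ _ regular_part_sub M0 regular_part_deg.
set W := energyR _ regular_part in h1 *; set b := (#|` regular_part|)%:R in nB *.
set V := energyR _ A in h1 *.
rewrite expr_div_n [X in _ <= X -> _]mulrAC ler_pdivlMr ?exprn_gt0 // => h2.
have h3 : n ^+ 6 <= (2 * b) ^+ 6 by rewrite lerXn2r ?nnegrE ?mulr_ge0 ?ler0n.
have W0 : 0 <= W by apply: sumr_ge0 => s _; apply: powR_ge0.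
have V0 : 0 <= V by apply: sumr_ge0 => s _; apply: powR_ge0.
have h4 : (gamma * V) ^+ 4 <= (2 ^+ 3 * W) ^+ 4.
  by rewrite lerXn2r ?nnegrE ?mulr_ge0 ?exprn_ge0.
have h5 : n ^+ 6 * (gamma * V) ^+ 4 <= (2 * b) ^+ 6 * (2 ^+ 3 * W) ^+ 4.
  by rewrite ler_pM ?exprn_ge0 ?mulr_ge0.
have := ler_wpM2l (exprn_ge0 27 (ltW n0)) h5.
rewrite (_ : n ^+ 27 * (n ^+ 6 * (gamma * V) ^+ 4) = gamma ^+ 4 * n ^+ 33 * V ^+ 4); last by ring.
move/le_trans; apply.
rewrite [leLHS](_ : _ = 2 ^+ 18 * (n ^+ 18 * b ^+ 6 * W ^+ 4 * n ^+ 9)); last by ring.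
rewrite [leRHS](_ : _ = 2 ^+ 18 * ((2 * E) ^+ 9 * G ^+ 4)); last by ring.
by rewrite ler_wpM2l ?exprn_ge0.
Qed.

Lemma energyP_connected2_log : connected 2 beta gamma A ->
  2^-1 ^+ 8 * gamma * n `^ (17 / 2) / (E `^ (3 / 2) * log2 n) <= G.
Proof.
move=> /energyP_connected2 h; have n0 := card_gt0; have E0 := energy_gt0.
have G0 : 0 <= G by rewrite ler0n.
apply: div_mul_le => //.
- by rewrite !mulr_ge0 ?invr_ge0 ?powR_ge0.
- exact: powR_gt0.
- by apply: log2_natr; rewrite cardfs_gt0.
(* Squaring makes the exponents 17/2 and 3/2 integral, and 2^(-16) absorbs 2^15. *)
rewrite -(ler_pXn2r (ltn0Sn 1)) ?nnegrE ?mulr_ge0 ?invr_ge0 ?powR_ge0 //.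
rewrite !exprMn !powR_frac ?(ltW E0) //.
have : 0 <= E ^+ 3 * G ^+ 2 by rewrite mulr_ge0 ?exprn_ge0 // ltW.
by move: h; lra.
Qed.

Lemma energyP_connected32_log : connected (3 / 2) beta gamma A ->
  2^-1 ^+ 8 * gamma * (n `^ (33 / 4) * energyR (3 / 2) A) / (E `^ (9 / 4) * log2 n)
    <= G.
Proof.
move=> /energyP_connected32 h; have n0 := card_gt0; have E0 := energy_gt0.
have G0 : 0 <= G by rewrite ler0n.
have V0 : 0 <= energyR (3 / 2) A :> R by apply: sumr_ge0 => s _; apply: powR_ge0.
apply: div_mul_le => //.
- by rewrite !mulr_ge0 ?invr_ge0 ?powR_ge0.
- exact: powR_gt0.
- by apply: log2_natr; rewrite cardfs_gt0.
(* Fourth powers clear 33/4 and 9/4, and 2^(-32) absorbs 2^27. *)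
rewrite -(ler_pXn2r (ltn0Sn 3)) ?nnegrE ?mulr_ge0 ?invr_ge0 ?powR_ge0 //.
rewrite !exprMn !powR_frac ?(ltW E0) //.
have : 0 <= E ^+ 9 * G ^+ 4 by rewrite mulr_ge0 ?exprn_ge0 // ltW.
by move: h; lra.
Qed.

End Connected.
End Model.
End LowerBounds.

Local Open Scope fset_scope.

Theorem theorem11 (R : realType) :
  exists c : R, 0 < c /\
  forall (T : zmodType) (A : {fset T}), A != fset0 ->
  let D := diffset A A in
  let S := sumset A A in
  let nA : R := (#|` A|)%:R in
  let nD : R := (#|` D|)%:R in
  let nS : R := (#|` S|)%:R in
  let EA : R := (energy A)%:R in
  (* first part *)
  ((energy3 D A)%:R ^+ 2 >= nA ^+ 13 / (nD ^+ 2 * EA) /\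
   (energy3 S A)%:R ^+ 2 >= nA ^+ 13 / (nD ^+ 2 * EA)) /\
  ((energyP 3 D D)%:R ^+ 4 >= Num.max (nD ^+ 12) (nA ^+ 45 / (EA ^+ 9 * nD ^+ 2)) /\
   (energyP 3 D S)%:R ^+ 4 >= Num.max (nS ^+ 12) (nA ^+ 45 / (EA ^+ 9 * nD ^+ 2))) /\
  (* connected part *)
  forall beta gamma : R, 0 <= beta -> beta <= 1/2 -> 0 <= gamma -> gamma <= 1 ->
  (connected 2 beta gamma A ->
     (energy3 D A)%:R ^+ 2 >= c * gamma * nA ^+ 5 * EA /\
     (energy3 S A)%:R ^+ 2 >= c * gamma * nA ^+ 5 * EA) /\
  (connected (3/2) beta gamma A ->
     (energyP 3 D D)%:R >= c * gamma * (nA `^ (33/4) * energyR (3/2) A)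
                                      / (EA `^ (9/4) * log2 nA) /\
     (energyP 3 D S)%:R >= c * gamma * (nA `^ (33/4) * energyR (3/2) A)
                                      / (EA `^ (9/4) * log2 nA)) /\
  (connected 2 beta gamma A ->
     (energyP 3 D D)%:R >= c * gamma * nA `^ (17/2) / (EA `^ (3/2) * log2 nA) /\
     (energyP 3 D S)%:R >= c * gamma * nA `^ (17/2) / (EA `^ (3/2) * log2 nA)).
Proof.
(* One constant serves all connected bounds: with c = 2^(-8), each of 32 c, 2^15 c^2 and 2^27 c^4 is
   at most 1. *)
exists (2^-1 ^+ 8); split; first by rewrite exprn_gt0 ?invr_gt0.
move=> T A A0 D S nA nD nS EA.
have modD := sum_model_diffset R T A; have modS := sum_model_sumset R T A.
split; first by split; apply: energy3_lower; eassumption.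
split; first by split; apply: energyP_lower; eassumption.
move=> beta gamma _ beta2 gamma0 _.
have e3 sg X : sum_model R T A sg X -> connected 2 beta gamma A ->
    2^-1 ^+ 8 * gamma * nA ^+ 5 * EA <= (energy3 X A)%:R ^+ 2.
  move=> modX conn; have := energy3_connected _ _ _ A0 _ _ modX _ _ beta2 gamma0 conn.
  by have := sqr_ge0 ((energy3 X A)%:R : R); rewrite /nA /EA; lra.
split; first by move=> conn; split; apply: e3; eassumption.
split=> [conn|conn]; split.
- exact: energyP_connected32_log modD _ _ beta2 gamma0 conn.
- exact: energyP_connected32_log modS _ _ beta2 gamma0 conn.
- exact: energyP_connected2_log modD _ _ beta2 gamma0 conn.
- exact: energyP_connected2_log modS _ _ beta2 gamma0 conn.
Qed.
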